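(* There exist no nonzero rational numbers $C, D$ such that the binary quadratic form $f(x,y) = Cx^2 + Dy^2$ has a periodic vector of type $(L,R,L,R)$ over $\mathbb{Q}$.
   Context: For $f : \mathbb{Q}^2 \to \mathbb{Q}$ define $f_L, f_R : \mathbb{Q}^2 \to \mathbb{Q}^2$ by $f_L(x,y) = (f(x,y), y)$ and $f_R(x,y) = (x, f(x,y))$. For a type $\mathbf{t} = (t_1,\ldots,t_N) \in \{L,R\}^N$ put $f_{\mathbf{t}} = f_{t_N} \circ \cdots \circ f_{t_1}$. A vector $\overline{v} \in \mathbb{Q}^2$ is a periodic vector of type $\mathbf{t}$ for $f$ over $\mathbb{Q}$ if $f_{\mathbf{t}}(\overline{v}) = \overline{v}$ and $f_{(t_1,\ldots,t_{N'})}(\overline{v}) \neq \overline{v}$ for all $1 \leq N' < N$. *)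

(* Defs.v *)
From mathcomp Require Import all_boot all_order all_algebra.

Set Implicit Arguments.
Unset Strict Implicit.
Unset Printing Implicit Defensive.

Import GRing.Theory Num.Theory.

Local Open Scope ring_scope.

Inductive side := L | R.

Definition step (f : rat * rat -> rat) (s : side) (v : rat * rat) : rat * rat :=
  match s with
  | L => (f v, v.2)
  | R => (v.1, f v)
  end.

(* The head of the type acts first: f_t = f_(t_N) \o ... \o f_(t_1). *)
Definition ftype (f : rat * rat -> rat) (t : seq side) (v : rat * rat) :
    rat * rat :=
  foldl (fun w s => step f s w) v t.

Definition periodic_vector (f : rat * rat -> rat) (t : seq side)
    (v : rat * rat) : Prop :=
  ftype f t v = v /\
  forall n : nat, (1 <= n < size t)%N -> ftype f (take n t) v <> v.

Definition diag_form (C D : rat) (v : rat * rat) : rat :=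
  C * v.1 ^+ 2 + D * v.2 ^+ 2.

(* Main.v *)
Require Import Defs.
From mathcomp Require Import all_boot all_order all_algebra.
From mathcomp Require Import zify ring lra.

(** Write the four points of the cycle as (a,c), (b,c), (b,d), (a,d).  The four
    equations force a + b = c + d; call this sum u and put p = a - b and
    q = c - d.  Two differences of the equations express C and D through p, q
    and u, and what remains is one homogeneous equation
      u^2 (q^2 - 6pq - p^2) = pq (p^2 + q^2),
    which is [orbit_quartic].  Minimality of the period gives p <> 0, and then
    q and u are nonzero too.  Thus p, q, scaled to coprime integers, yield a
    point with pq <> 0 on the genus 2 curve
      w^2 = pq (p^2 + q^2) (q^2 - 6pq - p^2)
    ([primitive_point]).

    Descent shows that there is none.  If p and q are both odd, the
    right side is 20 mod 32, which is not a square ([odd_pair_not_square]).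
    Otherwise p, q and p^2 + q^2 are pairwise coprime, and coprime to the
    last factor except that p^2 + q^2 might share a factor 5 with it.  Hence
    |p| = r^2 and |q| = s^2; now p^2 + q^2 = r^4 + s^4 is prime to 5 because
    fourth powers are 0 or 1 mod 5, so it is a square as well.  This contradicts
    Fermat's theorem that r^4 + s^4 is not a square for positive r and s
    ([sum_biquadrates_neq_square]). *)

Import GRing.Theory Num.Theory.

(** * Fermat's theorem on sums of two fourth powers *)

(** The square root is gcd(a, w): after dividing a and w by it, the two quotients
    are coprime, so a divided by the gcd and the gcd divide each other. *)
Lemma coprime_mul_square (a b w : nat) :
  coprime a b -> a * b = w ^ 2 -> exists r, a = r ^ 2.
Proof.
move=> cab abw; exists (gcdn a w).
have [a0|a_gt0] := posnP a.
  by move: abw; rewrite a0 mul0n => /esym/eqP; rewrite expn_eq0 => /andP[/eqP->].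
have [g_gt0 /eqP ga /eqP gw] : [/\ (0 < gcdn a w),
    (a %/ gcdn a w * gcdn a w == a) & (w %/ gcdn a w * gcdn a w == w)].
  by rewrite gcdn_gt0 a_gt0 -!dvdn_eq dvdn_gcdl dvdn_gcdr.
have cgb : coprime (gcdn a w) b by apply: coprime_dvdl (dvdn_gcdl _ _) cab.
have caw : coprime (a %/ gcdn a w) (w %/ gcdn a w).
  by rewrite /coprime -(eqn_pmul2r g_gt0) muln_gcdl ga gw mul1n.
move: g_gt0 ga gw cgb caw; move: (gcdn a w) (_ %/ _) (_ %/ _).
move=> g w' a' g_gt0 ga gw cgb caw.
have e : (a' * b = g * w' ^ 2).
  apply/eqP; rewrite -(eqn_pmul2r g_gt0) mulnAC ga abw -gw expnMn.
  by rewrite -(mulnn g) mulnA (mulnC g (w' ^ 2)).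
suff a'g : a' = g by rewrite -ga a'g mulnn.
apply/eqP; rewrite eq_sym eqn_dvd; apply/andP; split.
  by rewrite -(Gauss_dvdl _ cgb) e dvdn_mulr.
by rewrite -(Gauss_dvdl _ (coprimeXr 2 caw)) -e dvdn_mulr.
Qed.

Lemma coprime_mul_square_roots (a b w : nat) : coprime a b -> a * b = w ^ 2 ->
  exists r s, [/\ a = r ^ 2, b = s ^ 2 & w = r * s].
Proof.
move=> cab e.
have [r ar] := coprime_mul_square a b w cab e.
have [|s bs] := coprime_mul_square b a w _ (etrans (mulnC b a) e).
  by rewrite coprime_sym.
exists r, s; split=> //; apply/eqP.
by rewrite -(eqn_exp2r _ _ (isT : 0 < 2)) -e ar bs expnMn.
Qed.

(** With z = x + 2v the equation reads (x + v) v = h^2, and the two factors on the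
    left are coprime, so both are squares. *)
Lemma pythagorean_param (x h z : nat) : odd x -> coprime x (2 * h) ->
    (x ^ 2 + (2 * h) ^ 2 = z ^ 2) ->
  exists a b, [/\ coprime a b, x + b ^ 2 = a ^ 2, h = a * b &
                  z = a ^ 2 + b ^ 2].
Proof.
move=> ox cxh e.
have xz : x <= z by rewrite -(leq_exp2r _ _ (isT : 0 < 2)) -e leq_addr.
have oz : odd z.
  by have := congr1 odd e; rewrite oddD !oddX oddM /= ox addbF => <-.
have [v zE] : exists v, z = (x + 2 * v).
  exists ((z - x)./2); have := odd_double_half (z - x).
  by rewrite oddB // oz ox /= -mul2n; lia.
have uv : ((x + v) * v = h ^ 2) by move: e; rewrite zE; nia.
have cuv : coprime (x + v) v.
  rewrite /coprime gcdnC gcdnDr gcdnC -/(coprime x v).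
  have: coprime x (h ^ 2) by apply: coprimeXr; move: cxh; rewrite coprimeMr => /andP[].
  by rewrite -uv coprimeMr => /andP[].
have [a [b [ea eb eh]]] := coprime_mul_square_roots _ _ _ cuv uv.
exists a, b; split=> //; last by rewrite zE -ea -eb; lia.
  by move: cuv; rewrite ea eb coprime_pexpl // coprime_pexpr.
by rewrite -ea -eb.
Qed.

Lemma odd_sqr_mod4 (x : nat) : odd x -> exists k, (x ^ 2 = 4 * k + 1).
Proof.
move=> ox; exists (x./2 ^ 2 + x./2).
by rewrite -{1}(odd_double_half x) ox -mul2n; lia.
Qed.

Lemma sum_odd_sqr_neq_sqr (x y z : nat) :
  odd x -> odd y -> (x ^ 2 + y ^ 2 <> z ^ 2).
Proof.
move=> /odd_sqr_mod4[k ->] /odd_sqr_mod4[l ->] e.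
have ez : odd z = false.
  by have := congr1 odd e; rewrite oddX !oddD /=; case: (odd k); case: (odd l).
by have := odd_double_half z; rewrite ez -mul2n => zE; move: e; rewrite -zE; lia.
Qed.

(** Infinite descent on z.  With y even, parametrizing the Pythagorean triple
    (x^2, y^2, z) gives a triple x^2 + b^2 = a^2 with b even; parametrizing that
    one, with generators c and d, makes the pairwise coprime numbers c, d and
    a = c^2 + d^2 have a square product, so c = r^2, d = s^2 and r^4 + s^4 = a is
    a square.  Its root is at most a, which is less than z = a^2 + b^2. *)
Lemma sum_biquadrates_neq_square (x y z : nat) : 0 < x -> 0 < y ->
  coprime x y -> (x ^ 4 + y ^ 4 <> z ^ 2).
Proof.
elim/ltn_ind: z x y => z IHz x y.
wlog oy : x y / ~~ odd y.
  move=> W x0 y0 cxy e; case oy: (odd y); last by apply: (W x y); rewrite ?oy.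
  case ox: (odd x); last by apply: (W y x); rewrite ?ox // 1?coprime_sym // addnC.
  by apply: (@sum_odd_sqr_neq_sqr (x ^ 2) (y ^ 2) z); rewrite ?oddX ?ox ?oy // -!expnM.
move=> x0 y0 cxy e.
have [h yE] : exists h, y = (2 * h).
  by exists y./2; rewrite -{1}(odd_double_half y) (negbTE oy) mul2n.
have ox : odd x.
  by move: cxy; rewrite yE coprimeMr coprimen2 => /andP[].
have h0 : 0 < h by lia.
have [|||a [b [cab ex eh ez]]] := pythagorean_param (x ^ 2) (2 * h ^ 2) z.
- by rewrite oddX ox orbT.
- have -> : (2 * (2 * h ^ 2) = y ^ 2) by rewrite yE; lia.
  by rewrite coprime_pexpl // coprime_pexpr.
- by rewrite -e yE; lia.
have cxb : coprime x b.
  suff: coprime (x ^ 2) b by rewrite coprime_pexpl.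
  have: coprime b (b * b + x ^ 2) by rewrite mulnn addnC ex coprimeXr // coprime_sym.
  by rewrite (coprime_sym (x ^ 2)) /coprime gcdnMDl.
have ob : ~~ odd b by apply/negP => ob; apply: (sum_odd_sqr_neq_sqr _ _ _ ox ob ex).
have [k bE] : exists k, b = (2 * k).
  by exists b./2; rewrite -{1}(odd_double_half b) (negbTE ob) mul2n.
have [c [d [ccd exx ek ea]]] : exists c d, [/\ coprime c d, x + d ^ 2 = c ^ 2,
    k = c * d & a = c ^ 2 + d ^ 2].
  by apply: pythagorean_param; rewrite -?bE.
have hE : ((c * d) * a = h ^ 2) by apply/eqP; move: eh; rewrite bE ek; lia.
have cca : coprime c a.
  by rewrite ea -mulnn /coprime gcdnMDl -/(coprime c _) coprimeXr.
have cda : coprime d a.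
  by rewrite ea addnC -mulnn /coprime gcdnMDl -/(coprime d _) coprimeXr // coprime_sym.
have [||w [g [ew eg _]]] := coprime_mul_square_roots (c * d) a h => //.
  by rewrite coprimeMl cca.
have [r [s [ec ed _]]] := coprime_mul_square_roots _ _ _ ccd ew.
have k0 : 0 < c * d * a by rewrite hE expn_gt0 h0.
move: k0; rewrite !muln_gt0 => /andP[/andP[c0 d0] a0].
apply: (IHz g _ r s).
- have : g <= a by rewrite eg leq_pmulr //; lia.
  have : a <= a ^ 2 by rewrite leq_pmulr.
  have : 0 < b ^ 2 by rewrite bE ek expn_gt0 !muln_gt0 c0 d0.
  by rewrite ez; lia.
- by case: (r) ec c0 => // ->.
- by case: (s) ed d0 => // ->.
- by move: ccd; rewrite ec ed coprime_pexpl // coprime_pexpr.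
- by rewrite -eg ea ec ed -!expnM.
Qed.

(** * Congruence conditions *)

Lemma biquad_mod5 (m : nat) : m ^ 4 %% 5 = ~~ (5 %| m).
Proof.
rewrite -modnXm /dvdn; have := ltn_pmod m (isT : 0 < 5).
by case: (m %% 5) => [|[|[|[|[|]]]]].
Qed.

Lemma biquad_sum_mod5 (m n : nat) : coprime m n -> ~~ (5 %| m ^ 4 + n ^ 4).
Proof.
move=> cmn; rewrite /dvdn -modnDm !biquad_mod5.
case: (boolP (5 %| m)) => m5; case: (boolP (5 %| n)) => n5 //.
by have := dvdn_gcd 5 m n; rewrite m5 n5 (eqP cmn).
Qed.

Local Open Scope ring_scope.

(** The last factor of the sextic pq (p^2 + q^2) (q^2 - 6pq - p^2). *)
Definition residual_form {R : comNzRingType} (p q : R) : R :=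
  q ^+ 2 - 6 * p * q - p ^+ 2.

Lemma int_parity (i : int) : exists k, i = 2 * k \/ i = 2 * k + 1.
Proof. by exists (i %/ 2)%Z; lia. Qed.

Lemma consecutive_even (i : int) : exists t, i * (i + 1) = 2 * t.
Proof.
have [k [->|->]] := int_parity i; first by exists (k * (2 * k + 1)); ring.
by exists ((2 * k + 1) * (k + 1)); ring.
Qed.

(** The sextic is 20 mod 32 at two odd arguments. *)
Lemma odd_pair_not_square (i j w : int) :
  let p := 2 * i + 1 in let q := 2 * j + 1 in
  p * q * (p ^+ 2 + q ^+ 2) * residual_form p q <> w ^+ 2.
Proof.
move=> p q; rewrite /residual_form.
have [[t it] [s js]] := (consecutive_even i, consecutive_even j).
have pp : p ^+ 2 = 8 * t + 1.
  have -> : p ^+ 2 = 4 * (i * (i + 1)) + 1 by rewrite /p; ring.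
  by rewrite it; ring.
have qq : q ^+ 2 = 8 * s + 1.
  have -> : q ^+ 2 = 4 * (j * (j + 1)) + 1 by rewrite /q; ring.
  by rewrite js; ring.
(* Here p q = 2 h + 1 and, since odd squares are 1 mod 8, the sextic is
   4 (8 X + 5), whereas an even square is 0, 4 or 16 mod 32. *)
pose h := 2 * i * j + i + j; pose k := t + s; pose g := 4 * h * k + h + 2 * k.
pose X := g * (s - t) - 3 * (8 * t * s + t + s) * (4 * k + 1) - s - 2 * t - 1.
have -> : p * q * (p ^+ 2 + q ^+ 2) * (q ^+ 2 - 6 * p * q - p ^+ 2) =
    4 * (8 * X + 5).
  have -> : p * q * (p ^+ 2 + q ^+ 2) * (q ^+ 2 - 6 * p * q - p ^+ 2) =
    (p * q) * (p ^+ 2 + q ^+ 2) * (q ^+ 2 - p ^+ 2)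
     - 6 * (p ^+ 2) * (q ^+ 2) * (p ^+ 2 + q ^+ 2) by ring.
  have -> : p * q = 2 * h + 1 by rewrite /p /q /h; ring.
  by rewrite pp qq /X /g /k; ring.
have [v [->|->]] := int_parity w; last by lia.
have [e [->|->]] := int_parity v; first by lia.
have [f ef] := consecutive_even e.
have -> : (2 * (2 * e + 1)) ^+ 2 = 16 * (e * (e + 1)) + 4 by ring.
by rewrite ef; lia.
Qed.

(** * Splitting the sextic into squares *)

(** Modulo p the other factors are q, q^2 and q^2, and modulo q they are p, p^2
    and -p^2.  A common prime divisor of p^2 + q^2 and the residual form divides
    20 p q^2, a combination of the two; it is not 2 because p^2 + q^2, being prime
    to the even number p q, is odd. *)
Lemma sextic_coprime (p q : int) : coprimez p q -> (2 %| p * q)%Z ->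
  [/\ coprimez p (q * (p ^+ 2 + q ^+ 2) * residual_form p q),
      coprimez q (p * (p ^+ 2 + q ^+ 2) * residual_form p q) &
      ~~ (5 %| p ^+ 2 + q ^+ 2)%Z ->
      coprimez (p ^+ 2 + q ^+ 2) (p * q * residual_form p q)].
Proof.
move=> cpq even_pq.
have cqp : coprimez q p by rewrite coprimez_sym.
have cpN : coprimez p (p ^+ 2 + q ^+ 2).
  by rewrite expr2 /coprimez gcdzMDl; apply: coprimezXr.
have cqN : coprimez q (p ^+ 2 + q ^+ 2).
  by rewrite addrC expr2 /coprimez gcdzMDl; apply: coprimezXr.
have cpF : coprimez p (residual_form p q).
  have -> : residual_form p q = (- 6 * q - p) * p + q ^+ 2.
    by rewrite /residual_form; ring.
  by rewrite /coprimez gcdzMDl; apply: coprimezXr.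
have cqF : coprimez q (residual_form p q).
  have -> : residual_form p q = (q - 6 * p) * q - p ^+ 2.
    by rewrite /residual_form; ring.
  by rewrite /coprimez gcdzMDl -/(coprimez _ _) coprimezN; apply: coprimezXr.
split; first by rewrite !coprimezMr cpq cpN cpF.
  by rewrite !coprimezMr cqp cqN cqF.
have cNp : coprimez (p ^+ 2 + q ^+ 2) p by rewrite coprimez_sym.
have cNq : coprimez (p ^+ 2 + q ^+ 2) q by rewrite coprimez_sym.
move=> n5; rewrite !coprimezMr cNp cNq /=.
have cN2 : coprimez (p ^+ 2 + q ^+ 2) 2.
  rewrite coprimezE; apply: coprime_dvdr even_pq _.
  by rewrite -coprimezE coprimezMr cNp cNq.
have cN5 : coprimez (p ^+ 2 + q ^+ 2) 5.
  by rewrite coprimezE coprime_sym prime_coprime // -dvdzE.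
have : coprimez (p ^+ 2 + q ^+ 2) (- (2 * 2 * 5 * p * q ^+ 2)).
  by rewrite coprimezN !coprimezMr cN2 cN5 cNp cNq.
suff -> : coprimez (p ^+ 2 + q ^+ 2) (- (2 * 2 * 5 * p * q ^+ 2)) =
          coprimez (p ^+ 2 + q ^+ 2) (residual_form p q * (3 * q - p)).
  by rewrite coprimezMr => /andP[].
have -> : residual_form p q * (3 * q - p) =
    (3 * q + p) * (p ^+ 2 + q ^+ 2) + - (2 * 2 * 5 * p * q ^+ 2).
  by rewrite /residual_form; ring.
by rewrite /coprimez gcdzMDl.
Qed.

(** Both coordinates are squares up to sign by coprimality; the sum of their squares
    is then a sum of two fourth powers, hence prime to 5, hence a square too. *)
Lemma no_primitive_point (p q w : int) : p != 0 -> q != 0 -> coprimez p q ->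
  p * q * (p ^+ 2 + q ^+ 2) * residual_form p q <> w ^+ 2.
Proof.
move=> p0 q0 cpq e.
have even_pq : (2 %| p * q)%Z.
  have [[i [iE|iE]] [j [jE|jE]]] := (int_parity p, int_parity q).
  - by rewrite iE -mulrA dvdz_mulr.
  - by rewrite iE -mulrA dvdz_mulr.
  - by rewrite jE mulrCA dvdz_mulr.
  - by case: (odd_pair_not_square i j w); rewrite -iE -jE.
have [cp cq cN] := sextic_coprime p q cpq even_pq.
have split_square (x y : int) : coprimez x y -> x * y = w ^+ 2 ->
    exists r, `|x|%N = (r ^ 2)%N.
  rewrite coprimezE => cxy exy; apply: (coprime_mul_square _ _ `|w|%N cxy).
  by rewrite -abszM exy abszX.
have [r pE] : exists r, `|p|%N = (r ^ 2)%N.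
  by apply: split_square cp _; rewrite -e; ring.
have [s qE] : exists s, `|q|%N = (s ^ 2)%N.
  by apply: split_square cq _; rewrite -e; ring.
have NE : absz (p ^+ 2 + q ^+ 2) = (r ^ 4 + s ^ 4)%N.
  have -> : p ^+ 2 + q ^+ 2 = (`|p| ^ 2 + `|q| ^ 2)%N%:Z.
    by rewrite PoszD -!mulnn !PoszM -!expr2 !abszE !real_normK ?num_real.
  by rewrite absz_nat pE qE -!expnM.
have crs : coprime r s.
  by move: cpq; rewrite coprimezE pE qE coprime_pexpl // coprime_pexpr.
have [||z zE] := split_square _ _ (cN _) _.
- by rewrite dvdzE NE; exact: biquad_sum_mod5.
- by rewrite -e; ring.
- have r0 : (0 < r)%N.
    have := expn_gt0 r 2; rewrite orbF; move=> <-.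
    by rewrite -pE absz_gt0.
  have s0 : (0 < s)%N.
    have := expn_gt0 s 2; rewrite orbF; move=> <-.
    by rewrite -qE absz_gt0.
  by apply: (sum_biquadrates_neq_square r s z r0 s0 crs); rewrite -zE NE.
Qed.

(** * From a periodic vector to the sextic *)

Lemma int_square_of_rat_square (y : rat) (n : int) :
  y ^+ 2 = n%:~R -> exists w : int, n = w ^+ 2.
Proof.
move=> yn; exists (numq y).
have e : numq y ^+ 2 = n * denq y ^+ 2.
  apply/(@intr_inj rat); rewrite [LHS]rmorphXn [RHS]rmorphM /=.
  by rewrite [X in _ = _ * X]rmorphXn /= -yn numqE exprMn.
suff d1 : denq y = 1 by rewrite e d1 expr1n mulr1.
have : (denq y %| numq y)%Z.
  by rewrite dvdzE -(dvdn_pexp2r _ _ (isT : (0 < 2)%N)) -!abszX -dvdzE e dvdz_mull.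
rewrite dvdzE => /gcdn_idPr; rewrite (eqP (coprime_num_den y)) => d1.
by rewrite -absz_denq -d1.
Qed.

(** With k = p / P = q / Q, the equation gives (u / k)^2 times the residual form the
    value P Q (P^2 + Q^2), so multiplying u / k by that form gives a rational, hence
    integral, square root of the sextic at (P, Q). *)
Lemma primitive_point (p q u : rat) : p != 0 -> q != 0 -> u != 0 ->
    u ^+ 2 * residual_form p q = p * q * (p ^+ 2 + q ^+ 2) ->
  exists P Q W : int, [/\ P != 0, Q != 0, coprimez P Q &
    P * Q * (P ^+ 2 + Q ^+ 2) * residual_form P Q = W ^+ 2].
Proof.
rewrite /residual_form; move=> p0 q0 u0 e.
pose P := denq (q / p); pose Q := numq (q / p).
have P0 : P != 0 by apply: denq_neq0.
have Q0 : Q != 0 by rewrite numq_eq0 mulf_neq0 ?invr_eq0.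
have Pr0 : P%:~R != 0 :> rat by rewrite intr_eq0.
pose k := p / P%:~R; have pE : p = k * P%:~R by rewrite /k divfK.
have k0 : k != 0 by rewrite mulf_neq0 ?invr_eq0.
have qE : q = k * Q%:~R by rewrite /Q numqE -/P /k; field; rewrite Pr0 p0.
have [W WE] : exists W : int,
    P * Q * (P ^+ 2 + Q ^+ 2) * residual_form P Q = W ^+ 2.
  apply: (@int_square_of_rat_square (u / k * (residual_form P Q)%:~R)).
  move: e; rewrite /residual_form pE qE !(rmorphM, rmorphB, rmorphD, rmorphXn) /=.
  move: (P%:~R) (Q%:~R) => x y e.
  have {}e : (u / k) ^+ 2 * (y ^+ 2 - 6 * x * y - x ^+ 2) = x * y * (x ^+ 2 + y ^+ 2).
    apply: (mulfI (_ : k ^+ 4 != 0)); first by rewrite expf_neq0.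
    transitivity (u ^+ 2 * ((k * y) ^+ 2 - 6 * (k * x) * (k * y) - (k * x) ^+ 2)).
      by field.
    by rewrite e; ring.
  by rewrite -e; ring.
exists P, Q, W; split=> //.
by rewrite coprimez_sym coprimezE coprime_num_den.
Qed.

(** Here u = a + b = c + d, p = a - b, q = c - d, and differences of the hypotheses
    give q - p = 2 C p u and - (q + p) = 2 D q u; these two eliminate C and D from
    b = C a^2 + D c^2.  The terms linear in u cancel. *)
Lemma orbit_quartic (C D a b c d : rat) : a != b ->
  b = C * a ^+ 2 + D * c ^+ 2 -> d = C * b ^+ 2 + D * c ^+ 2 ->
  a = C * b ^+ 2 + D * d ^+ 2 -> c = C * a ^+ 2 + D * d ^+ 2 ->
  exists p q u : rat, [/\ p != 0, q != 0, u != 0 &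
    u ^+ 2 * residual_form p q = p * q * (p ^+ 2 + q ^+ 2)].
Proof.
move=> ab e1 e2 e3 e4.
have sE : a + b = c + d by lra.
set u := a + b; set p := a - b; set q := c - d.
have r1 : q - p = 2 * C * p * u.
  have -> : q - p = 2 * (b - d) by rewrite /q /p; lra.
  have -> : b - d = C * (a ^+ 2 - b ^+ 2) by lra.
  by rewrite /p /u; ring.
have r2 : - (q + p) = 2 * D * q * u.
  have -> : - (q + p) = 2 * (d - a) by rewrite /q /p; lra.
  have -> : d - a = D * (c ^+ 2 - d ^+ 2) by lra.
  by rewrite /q /u sE; ring.
have p0 : p != 0 by rewrite subr_eq0.
have q0 : q != 0.
  by apply: contraNneq p0 => q0; move: r2; rewrite q0 add0r mulr0 mul0r => /eqP;
     rewrite oppr_eq0.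
have u0 : u != 0.
  apply: contraNneq p0 => u0; move: r1 r2; rewrite u0 !mulr0 => ? ?.
  by apply/eqP; lra.
exists p, q, u; split=> //.
have hb : u - p = 2 * b by rewrite /u /p; ring.
have ha : u + p = 2 * a by rewrite /u /p; ring.
have hc : u + q = 2 * c by rewrite /u /q sE; ring.
have e : 2 * (u - p) = C * (u + p) ^+ 2 + D * (u + q) ^+ 2.
  by rewrite hb ha hc; lra.
have : 4 * p * q * u * (u - p) =
    (2 * C * p * u) * q * (u + p) ^+ 2 + (2 * D * q * u) * p * (u + q) ^+ 2.
  have -> : 4 * p * q * u * (u - p) = 2 * (p * q * u) * (2 * (u - p)) by ring.
  by rewrite e; ring.
rewrite /residual_form -r1 -r2 => h; apply/eqP; rewrite -subr_eq0; apply/eqP.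
move/eqP: h; rewrite -subr_eq0 => /eqP h.
by rewrite -[RHS]oppr0 -h; ring.
Qed.

Theorem theorem1p8 :
  ~ exists C D : rat, [/\ C != 0, D != 0 &
      exists v : rat * rat, periodic_vector (diag_form C D) [:: L; R; L; R] v].
Proof.
move=> [C [D [_ _ [[a c] [per min_per]]]]].
move: per (min_per 1%N isT); rewrite /ftype /= /diag_form /=.
set b := C * a ^+ 2 + _; set d := C * b ^+ 2 + D * c ^+ 2 => -[e3].
rewrite e3 => e4 ne.
have ab : a != b by apply/eqP => ab; apply: ne; rewrite -ab.
have [p [q [u [p0 q0 u0 e]]]] :=
  orbit_quartic C D a b c d ab erefl erefl (esym e3) (esym e4).
have [P [Q [W [P0 Q0 cPQ eW]]]] := primitive_point p q u p0 q0 u0 e.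
exact: no_primitive_point P0 Q0 cPQ eW.
Qed.
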